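(* Consider the conforming tree setup and the tree algorithm described in the context, and assume that the local errors are subadditive, i.e. $\sum_{j=1}^J e(\Delta_j)\le e(\Delta)$ whenever $\Delta_1,\dots,\Delta_J$ are the children of a cell $\Delta\in T_\Omega$. Let $T_N$ be the tree generated by the algorithm at iteration $N$. Then $$E(T_N)\le \min_{0\le n\le N}\left(\frac{N+1+(\Theta-1)n}{N-n+1}\,\sigma_n\right).$$ Consequently, the output trees of the algorithm are near best with respect to $|\cdot|$, i.e. there exist constants $C_1,C_2>0$ such that every output tree $T$ satisfies $E(T)\le C_1\,\sigma_{C_2|T|}$.
   Context: **Master tree.** Let $\Omega\subseteq\mathbb{R}^d$ be a domain, and let $T_\Omega$ be an infinite tree with root $\Omega$ whose nodes (cells) are open subsets of $\mathbb{R}^d$. Every cell $\Delta\in T_\Omega$ has finitely many children $\Delta_1,\dots,\Delta_J$, where $J\ge 2$ may depend on $\Delta$, which are pairwise disjoint open sets with $\overline{\Delta}=\bigcup_{j}\overline{\Delta_j}$. Replacing $\Delta$ by its children is called subdivision of $\Delta$. The parent of $\Delta$ is denoted $p(\Delta)$. For a subtree $T$ of $T_\Omega$, $\mathcal{L}(T)$ is the set of its leaves (nodes without children in $T$). $T$ is full if each non-leaf node of $T$ has all of its $T_\Omega$-children in $T$. **Conforming trees.** A class of partitions of $\Omega$ induced by full subtrees rooted at $\Omega$ is prescribed; its members are called conforming meshes. A full subtree rooted at $\Omega$ is conforming if its leaves form a conforming mesh. $\mathbb{T}^{C}$ denotes the set of all subtrees of $T_\Omega$ that are rooted at $\Omega$,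 full and conforming. The trivial tree $\{\Omega\}$ belongs to $\mathbb{T}^C$. **Subdivision patches.** Let $s$ be a nonempty set of cells appearing in some conforming mesh. Its subdivisions are isolated if, for any conforming mesh containing $s$, replacing all cells in $s$ by their children gives again a conforming mesh. If $s$ is minimal with this property (no proper nonempty subset has isolated subdivisions), $s$ is a subdivision patch. Standing assumptions: 1. for every cell $\Delta\in T_\Omega$ there is a unique subdivision patch $s(\Delta)$ with $\Delta\in s(\Delta)$; 2. for any leaf $\Delta\in\mathcal{L}(T)$ of any $T\in\mathbb{T}^C$, there is a subdivision patch $s\subseteq\mathcal{L}(T)$ that is necessary for subdividing $\Delta$. Here a patch $s$ is necessary for subdividing $\Delta$ if, for all $T\in\mathbb{T}^C$, $\Delta\in T\setminus\mathcal{L}(T)$ implies $s\subseteq T\setminus\mathcal{L}(T)$. Set $\Theta:=\max_{\Delta\in T_\Omega}\#s(\Delta)\ge1$ (assumed finite), and for $T\in\mathbb{T}^C$ $$|T|:=\#\{s\subseteq T\setminus\mathcal{L}(T)\mid s\text{ is a subdivision patch}\}.$$ **Errors.** Each cell $\Delta\in T_\Omega$ carries a local error $e(\Delta)\in[0,\infty)$. For $T\in\mathbb{T}^C$ put $E(T):=\sum_{\Delta\in\mathcal{L}(T)}e(\Delta)$, and $\sigma_n:=\min\{E(T)\mid T\in\mathbb{T}^C,\ |T|\le n\}$ (the same formula for a real index $n\ge0$). **Algorithm.** Conventions: $1/0=\infty$, $r+\infty=\infty$ for $r\in\mathbb{R}\cup\{\infty\}$, $1/\infty=0$. Initialize $T_0=\{\Omega\}$,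 $\nu(\Omega)=0$, $\mu(\Omega)=e(\Omega)$, $n=0$. While $t_n:=\max_{\Delta\in\mathcal{L}(T_n)}\mu(\Delta)>0$ (or until some alternative stopping test applies), do: - mark some $\Delta^\star_n\in\mathcal{L}(T_n)$ with $\mu(\Delta^\star_n)=t_n$; - pick a subdivision patch $s_n\subseteq\mathcal{L}(T_n)$ that is necessary for subdividing $\Delta^\star_n$; - let $T_{n+1}$ be $T_n$ together with the set $C_n$ of all children of the cells in $s_n$; - set $\nu(\Delta^\star_n)\leftarrow \frac1{e(\Delta^\star_n)}+\nu(\Delta^\star_n)$; - if $\Delta^\star_n\notin s_n$, set $\mu(\Delta^\star_n)\leftarrow\big(\frac1{e(\Delta^\star_n)}+\nu(\Delta^\star_n)\big)^{-1}$ (with the new value of $\nu$); - for all $\Delta\in C_n$, set $\nu(\Delta)\leftarrow\nu(p(\Delta))$ and $\mu(\Delta)\leftarrow\big(\frac1{e(\Delta)}+\nu(\Delta)\big)^{-1}$; - $n\leftarrow n+1$. The choices of $\Delta^\star_n$ and $s_n$ are arbitrary subject to these requirements. $T_N$ is the tree present when the iteration counter equals $N$ (for any $N$ reached by the algorithm); the output trees are the trees $T_N$. *)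

(* Defs.v *)
From HB Require Import structures.
From mathcomp Require Import all_boot all_order all_algebra finmap.
From mathcomp Require Import all_classical all_reals all_analysis.

Set Implicit Arguments.
Unset Strict Implicit.
Unset Printing Implicit Defensive.

Import Order.TTheory GRing.Theory Num.Theory.
Import numFieldNormedType.Exports.

Local Open Scope classical_set_scope.
Local Open Scope ring_scope.

Section Trees.
Context {C : choiceType} (Omega : C) (ch : C -> set C).

(* The nodes of the master tree with root [Omega] and children map [ch]; the
   values of [ch] outside of [cell] are irrelevant. *)
Inductive cell : set C :=
| cell_root : cell Omega
| cell_child D D' : cell D -> ch D D' -> cell D'.

(* Together with reachability from the root, which is built into [cell], this
   makes [ch] a tree on [cell]. *)
Definition tree_axioms : Prop :=
  (forall D, cell D -> ~ ch D Omega) /\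
  (forall D1 D2 D', cell D1 -> cell D2 -> ch D1 D' -> ch D2 D' -> D1 = D2).

Definition rooted_subtree (T : set C) : Prop :=
  [/\ T `<=` cell, T Omega &
      forall D D', cell D -> ch D D' -> T D' -> T D].

Definition leaves (T : set C) : set C :=
  [set D | T D /\ forall D', ch D D' -> ~ T D'].

Definition inner (T : set C) : set C := T `\` leaves T.

Definition full (T : set C) : Prop := forall D, inner T D -> ch D `<=` T.

Definition full_rooted_subtree (T : set C) : Prop :=
  rooted_subtree T /\ full T.

Section Conforming.
Variable conf : set (set C). (* the prescribed class of conforming meshes *)

(* Trees are not required to be finite. *)
Definition conforming_tree (T : set C) : Prop :=
  full_rooted_subtree T /\ conf (leaves T).

Definition in_some_mesh (s : set C) : Prop := exists2 M, conf M & s `<=` M.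

Definition subdivide (M s : set C) : set C :=
  (M `\` s) `|` \bigcup_(D in s) ch D.

Definition isolated (s : set C) : Prop :=
  forall M, conf M -> s `<=` M -> conf (subdivide M s).

Definition subdivision_patch (s : set C) : Prop :=
  [/\ s !=set0, in_some_mesh s, isolated s &
      forall s', s' `<` s -> s' !=set0 -> ~ isolated s'].

Definition necessary (s : set C) (D : C) : Prop :=
  forall T, conforming_tree T -> inner T D -> s `<=` inner T.

Definition unique_patches : Prop :=
  forall D, cell D -> exists! s, subdivision_patch s /\ s D.

Definition patch_of (D : C) : set C := xget set0 [set s | subdivision_patch s /\ s D].

Definition necessary_patches : Prop :=
  forall T D, conforming_tree T -> leaves T D ->
  exists s, [/\ subdivision_patch s, s `<=` leaves T & necessary s D].

(* [counting] is the number of elements, [+oo] for an infinite set. *)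
Definition is_max_patch_size (R : realType) (Theta : nat) : Prop :=
  (forall D, cell D -> counting (patch_of D) <= Theta%:R%:E :> \bar R)%E /\
  (exists2 D, cell D & counting (patch_of D) = Theta%:R%:E :> \bar R).

Definition tree_size (R : realType) (T : set C) : \bar R :=
  counting [set s | subdivision_patch s /\ s `<=` inner T].

Section Errors.
Context {R : realType} (e : C -> R).

Definition subadditive_errors : Prop :=
  forall D, cell D -> \sum_(D' \in ch D) e D' <= e D.

Definition tree_error (T : set C) : \bar R := \esum_(D in leaves T) (e D)%:E.

(* The best error with at most [x] patches: the infimum is a minimum, being
   taken over a nonempty finite set of trees when [x] is finite and
   nonnegative. *)
Definition sigma (x : \bar R) : \bar R :=
  ereal_inf [set tree_error T | T in
    [set T | conforming_tree T /\ (tree_size R T <= x)%E]].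

(* The values of [nu] and [mu] outside of [tree] are irrelevant. *)
Record state := State {
  tree : set C;
  nu : C -> \bar R;
  mu : C -> \bar R }.

Local Open Scope ereal_scope.

Definition initial (x : state) : Prop :=
  [/\ tree x = [set Omega], nu x Omega = 0 & mu x Omega = (e Omega)%:E].

Definition threshold (x : state) : \bar R :=
  ereal_sup [set mu x D | D in leaves (tree x)].

(* One pass through the loop, marking [D] and subdividing [s]. In [\bar R],
   [0^-1 = +oo] and [+oo^-1 = 0]. *)
Record iteration (D : C) (s : set C) (x y : state) : Prop := Iteration {
  it_continue : 0 < threshold x;
  it_leaf : leaves (tree x) D;
  it_mark : mu x D = threshold x;
  it_patch : subdivision_patch s;
  it_patch_leaves : s `<=` leaves (tree x);
  it_necessary : necessary s D;
  it_tree : tree y = tree x `|` \bigcup_(P in s) ch P;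
  it_nu_mark : nu y D = (e D)%:E^-1 + nu x D;
  it_mu_mark : ~ s D -> mu y D = ((e D)%:E^-1 + nu y D)^-1;
  it_nu_child : forall P P', s P -> ch P P' -> nu y P' = nu y P;
  it_mu_child : forall P P', s P -> ch P P' ->
    mu y P' = ((e P')%:E^-1 + nu y P')^-1;
  it_nu_keep : forall P, tree x P -> P <> D -> nu y P = nu x P;
  it_mu_keep : forall P, tree x P -> P <> D \/ s D -> mu y P = mu x P }.

(* [reached N x]: some run of the algorithm is in state [x] when its iteration
   counter equals [N]. *)
Inductive reached : nat -> state -> Prop :=
| reached0 x : initial x -> reached 0%N x
| reachedS N x y D s : reached N x -> iteration D s x y -> reached N.+1 y.

Definition output_tree (T : set C) : Prop :=
  exists N x, reached N x /\ tree x = T.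

End Errors.
End Conforming.
End Trees.

Section MasterTree.
Context {R : realType} {d : nat}.
Implicit Types (Omega : set 'rV[R]_d) (ch : set 'rV[R]_d -> set (set 'rV[R]_d)).

Definition domain Omega : Prop :=
  [/\ open Omega, connected Omega & Omega !=set0].

Record master_tree Omega ch : Prop := MasterTree {
  mt_domain : domain Omega;
  mt_tree : tree_axioms Omega ch;
  mt_open : forall D, cell Omega ch D -> open D;
  mt_finite : forall D, cell Omega ch D -> finite_set (ch D);
  mt_two : forall D, cell Omega ch D -> (2 <= #|` fset_set (ch D)|)%N;
  mt_disjoint : forall D, cell Omega ch D -> trivIset (ch D) id;
  mt_closure : forall D, cell Omega ch D ->
    closure D = \bigcup_(D' in ch D) closure D' }.

(* For a finite family the closure of the union is the union of the
   closures. *)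
Definition partition_of Omega (M : set (set 'rV[R]_d)) : Prop :=
  trivIset M id /\ closure Omega = closure (\bigcup_(D in M) D).

Record conforming_class Omega ch (conf : set (set (set 'rV[R]_d))) : Prop :=
  ConformingClass {
    cc_partition : forall M, conf M -> partition_of Omega M;
    cc_induced : forall M, conf M ->
      exists2 T, full_rooted_subtree Omega ch T & M = leaves ch T;
    cc_trivial : conforming_tree Omega ch conf [set Omega] }.

End MasterTree.

(* Main.v *)
Require Import Defs.
From HB Require Import structures.
From mathcomp Require Import all_boot all_order all_algebra finmap.
From mathcomp Require Import all_classical all_reals all_analysis.
From mathcomp Require Import ring lra zify.

Set Implicit Arguments.
Unset Strict Implicit.
Unset Printing Implicit Defensive.

Import Order.TTheory GRing.Theory Num.Theory.
Import numFieldNormedType.Exports.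

Local Open Scope classical_set_scope.
Local Open Scope ring_scope.

(** Fix a comparison tree S with m <= N patches and follow the algorithm up to
    its tree T at iteration N.

    Marking D adds 1/e(D) to nu(D), hence adds exactly 1 to the sum of e nu
    over any set of leaves that contains D, while subdivision can only decrease
    such a sum, because e is subadditive and children inherit nu.  Two such
    sums give the two halves of the estimate.  Let M count the markings of cells
    that are interior to S.  Necessity of the chosen patches forces each such
    marking to subdivide a patch of S, and patches are never reused, so M <= m.

    Upper half.  Let t be the current maximum of mu = e / (1 + e nu).  The leaves
    F of T that are interior to S satisfy e <= t (1 + e nu), and the sum of
    e nu over F is at most M ([inside_sum_step]).  Since M also is at most the
    number of interior cells of S that are already subdivided, #F + M is at most
    the number of interior cells of S, hence at most Theta m.  So these leaves
    carry an error of at most t Theta m.  The other leaves of T are leaves of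
    the overlay of T and S, whose error is at most E(S).

    Lower half.  Over the leaves of the overlay, the sum of e (1 - t nu) starts
    at E(S), loses t at each of the N - M other markings, and stays nonnegative
    because the threshold decreases along the run, so that t nu <= 1 throughout
    ([overlay_sum_step], [nu_bound]).  The leaf that attains t
    contributes one further t: either it is interior to S, and then M < m, or
    its own weight e (1 - t nu) equals t.  Hence t (N + 1 - m) <= E(S)
    ([threshold_lower_bound]).

    Together E(T) <= (1 + Theta m / (N + 1 - m)) E(S) ([run_near_best]), which
    is the stated factor.  Comparison trees may be infinite a priori, but a
    conforming tree with at most m patches is obtained from the root by at most
    m patch subdivisions ([conforming_grown]), hence is finite.  For the
    last claim, T_N has exactly N patches, and m <= N / 2 makes the factor at
    most 1 + Theta. *)

(** * Finite sets and finite sums *)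

Section FiniteSets.
Context {C : choiceType}.
Implicit Types (A B s : set C).

Lemma card_subset A B : finite_set B -> A `<=` B ->
  (#|` fset_set A| <= #|` fset_set B|)%N.
Proof.
move=> fB AB; have fA : finite_set A by exact: sub_finite_set fB.
by apply: fsubset_leq_card; move: AB; rewrite (fset_set_sub fA fB).
Qed.

Lemma card_subset_lt A B x : finite_set B -> A `<=` B -> B x -> ~ A x ->
  (#|` fset_set A| < #|` fset_set B|)%N.
Proof.
move=> fB AB Bx Ax; have fA : finite_set A by exact: sub_finite_set fB.
apply: fproper_ltn_card; rewrite fproperEneq.
move: (AB); rewrite (fset_set_sub fA fB) => ->; rewrite andbT.
apply/eqP => /(fset_set_inj fA fB) eAB.
by apply: Ax; rewrite eAB.
Qed.

Lemma card_union A B : finite_set A -> finite_set B ->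
  (#|` fset_set (A `|` B)| <= #|` fset_set A| + #|` fset_set B|)%N.
Proof. by move=> fA fB; rewrite fset_setU// cardfsU leq_subr. Qed.

Lemma card_disjoint_union A B : finite_set A -> finite_set B ->
  A `&` B `<=` set0 ->
  #|` fset_set (A `|` B)| = (#|` fset_set A| + #|` fset_set B|)%N.
Proof.
move=> fA fB AB; rewrite fset_setU// cardfsU -fset_setI//.
by move: AB; rewrite subset0 => ->; rewrite fset_set0 cardfs0 subn0.
Qed.

Lemma counting_le_nat (R : realType) A n :
  (counting A <= n%:R%:E :> \bar R)%E ->
  finite_set A /\ (#|` fset_set A| <= n)%N.
Proof.
rewrite /counting; case: asboolP => // fA.
by rewrite lee_fin ler_nat.
Qed.

Context {R : realType}.
Implicit Types f g h : C -> R.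

Lemma fsum_le A f g : finite_set A -> (forall x, A x -> f x <= g x) ->
  \sum_(x \in A) f x <= \sum_(x \in A) g x.
Proof.
move=> fA fg; rewrite !fsbig_finite//= big_seq [leRHS]big_seq.
by apply: ler_sum => x; rewrite in_fset_set// inE; exact: fg.
Qed.

Lemma fsum_subset A B f : finite_set B -> A `<=` B ->
  (forall x, B x -> 0 <= f x) -> \sum_(x \in A) f x <= \sum_(x \in B) f x.
Proof.
move=> fB AB f0.
have -> : A = B `&` A by rewrite setIC; apply/esym/setIidl.
by rewrite fsbig_mkcondr; apply: fsum_le => // x Bx; case: ifP => // _; exact: f0.
Qed.

Lemma fsum_union_le A B f : finite_set A -> finite_set B ->
  (forall x, B x -> 0 <= f x) ->
  \sum_(x \in A `|` B) f x <= \sum_(x \in A) f x + \sum_(x \in B) f x.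
Proof.
move=> fA fB f0.
have -> : A `|` B = A `|` (B `\` A) by rewrite setUDr setDv setD0.
rewrite fsbigU0//=; last 2 first.
- exact: finite_setD.
- by move=> x [? []].
by rewrite lerD2l; apply: fsum_subset => // x [].
Qed.

(** Union bound: a point in several of the sets is counted once on the left
    and at least once on the right. *)
Lemma fsum_bigcup_le s (F : C -> set C) f : finite_set s ->
  (forall i, s i -> finite_set (F i)) ->
  (forall i x, s i -> F i x -> 0 <= f x) ->
  \sum_(x \in \bigcup_(i in s) F i) f x <=
  \sum_(i \in s) \sum_(x \in F i) f x.
Proof.
move=> fs fF f0; set U := \bigcup_(i in s) F i.
have fU : finite_set U by apply: bigcup_finite.
have E i : s i -> F i = U `&` F i.
  by move=> si; rewrite setIC; apply/esym/setIidl => x Fx; exists i.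
rewrite [leRHS](eq_fsbigr (fun i => \sum_(x \in U) (if x \in F i then f x else 0)));
  last first.
  by move=> i; rewrite inE => si; rewrite -fsbig_mkcondr -(E i si).
rewrite exchange_fsbig//; apply: fsum_le => // x [i si Fx].
rewrite (fsbigD1 i)//= mem_set// lerDl; apply: fsumr_ge0 => j [sj _].
by case: ifPn => //; rewrite inE; exact: f0.
Qed.

Lemma finite_max f A x0 : finite_set A -> A x0 ->
  exists2 x, A x & forall y, A y -> f y <= f x.
Proof.
move=> fA Ax0.
have x0A : x0 \in fset_set A by rewrite in_fset_set// mem_set.
case: (@arg_maxP _ _ _ [` x0A]%fset xpredT (fun x => f (val x))) => // x _ maxx.
exists (val x) => [|y Ay].
  by have := valP x; rewrite in_fset_set// inE.
have yA : y \in fset_set A by rewrite in_fset_set// mem_set.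
exact: maxx [` yA]%fset _.
Qed.

End FiniteSets.

(** * Subdivision and overlay of trees *)

Section Subdivision.
Context {C : choiceType} (Omega : C) (ch : C -> set C).
Context (tree_ch : tree_axioms Omega ch).
Context (ch_finite : forall D, cell Omega ch D -> finite_set (ch D)).
Context (ch_nonempty : forall D, cell Omega ch D -> ch D !=set0).
Implicit Types (S T s : set C) (D P : C).

Definition grow T s : set C := T `|` \bigcup_(P in s) ch P.

Lemma innerP T D : inner ch T D <-> T D /\ exists2 D', ch D D' & T D'.
Proof.
split=> [[TD nl]|[TD [D' chD TD']]]; last by split=> // -[_ /(_ _ chD)].
split=> //; apply: contrapT => nex; apply: nl; split=> // D' chD TD'.
by apply: nex; exists D'.
Qed.

Lemma inner_sub T : inner ch T `<=` T. Proof. by move=> D []. Qed.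

Lemma leaves_sub T : leaves ch T `<=` T. Proof. by move=> D []. Qed.

Lemma inner_mono S T : S `<=` T -> inner ch S `<=` inner ch T.
Proof.
move=> ST D /innerP[/ST TD [D' chD /ST TD']].
by apply/innerP; split=> //; exists D'.
Qed.

Section Grow.
Context (T s : set C) (frT : full_rooted_subtree Omega ch T).
Context (sT : s `<=` leaves ch T).

Lemma subtree_cell D : T D -> cell Omega ch D.
Proof. by case: frT => -[Tc _ _] _; exact: Tc. Qed.

Lemma patch_cell D : s D -> cell Omega ch D.
Proof. by move=> /sT[/subtree_cell]. Qed.

Lemma new_child P D : s P -> ch P D -> ~ T D.
Proof. by move=> /sT[_ +] chD; exact. Qed.

Lemma grow_inner : inner ch (grow T s) = inner ch T `|` s.
Proof.
have [[Tc TO up] fT] := frT; have [_ uniq_p] := tree_ch.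
apply/seteqP; split=> D.
  move=> /innerP[gD [D' chD gD']].
  have cD : cell Omega ch D.
    by case: gD => [/Tc//|[P sP chP]]; exact: cell_child (patch_cell sP) chP.
  case: gD' => [TD'|[P sP chP]].
    by left; apply/innerP; split; [exact: up TD'|exists D'].
  by right; rewrite -(uniq_p _ _ _ (patch_cell sP) cD chP chD).
case=> [iD|sD]; first by apply: inner_mono iD; exact: subsetUl.
apply/innerP; split; first by left; exact: leaves_sub (sT sD).
have [D' chD] := ch_nonempty (patch_cell sD).
by exists D' => //; right; exists D.
Qed.

(** This identifies subdivision of trees with subdivision of meshes, which is
    what isolation of a patch speaks about. *)
Lemma grow_leaves : leaves ch (grow T s) = subdivide ch (leaves ch T) s.
Proof.
have [[Tc TO up] fT] := frT; have [_ uniq_p] := tree_ch.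
apply/seteqP; split=> D.
  move=> lD; have : ~ inner ch (grow T s) D by move=> [_]; exact.
  rewrite grow_inner => /not_orP[niD nsD].
  case: lD => -[TD|chD] _; last by right.
  left; split=> //; apply: contrapT => nl; exact: niD.
move=> lD; apply: contrapT => nl.
have gD : grow T s D.
  by case: lD => [[[TD _] _]|chD]; [left|right].
have : inner ch (grow T s) D by [].
rewrite grow_inner; case: lD => [[lD nsD] [[_ /(_ lD)]//|//]|[P sP chP]].
have nT := new_child sP chP.
by case=> [/inner_sub//|/sT/leaves_sub].
Qed.

Lemma grow_full_rooted : full_rooted_subtree Omega ch (grow T s).
Proof.
have [[Tc TO up] fT] := frT; have [_ uniq_p] := tree_ch.
split; last first.
  move=> D; rewrite grow_inner => -[iD|sD] D' chD; last by right; exists D.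
  by left; apply: fT iD _ chD.
split; [|by left|].
  by move=> D [/Tc//|[P sP chP]]; exact: cell_child (patch_cell sP) chP.
move=> D D' cD chD [TD'|[P sP chP]]; first by left; exact: up TD'.
left; rewrite -(uniq_p _ _ _ (patch_cell sP) cD chP chD).
exact: leaves_sub (sT sP).
Qed.

Lemma grow_finite : finite_set T -> finite_set (grow T s).
Proof.
move=> fT; rewrite /grow finite_setU; split=> //; apply: bigcup_finite.
  by apply: sub_finite_set fT => D /sT/leaves_sub.
by move=> P /patch_cell; exact: ch_finite.
Qed.

End Grow.

Lemma leaves_finite T : finite_set T -> finite_set (leaves ch T).
Proof. by apply: sub_finite_set; exact: leaves_sub. Qed.

Lemma inner_finite T : finite_set T -> finite_set (inner ch T).
Proof. by apply: sub_finite_set; exact: inner_sub. Qed.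

Lemma leaf_not_inner T D : leaves ch T D -> ~ inner ch T D.
Proof. by move=> lD []. Qed.

(* The overlay [T `|` S] refines both trees; it lets errors on T and on S be
   compared without a descendant relation between cells. *)
Section Overlay.
Context (S T : set C).
Context (frS : full_rooted_subtree Omega ch S).
Context (frT : full_rooted_subtree Omega ch T).

Lemma overlay_inner : inner ch (T `|` S) = inner ch T `|` inner ch S.
Proof.
have [[Tc _ upT] _] := frT; have [[Sc _ upS] _] := frS.
apply/seteqP; split=> D; last first.
  by case; apply: inner_mono; [exact: subsetUl|exact: subsetUr].
move=> /innerP[UD [D' chD [TD'|SD']]];
  (have cD : cell Omega ch D by case: UD => [/Tc|/Sc]).
- by left; apply/innerP; split; [exact: upT TD'|exists D'].
- by right; apply/innerP; split; [exact: upS SD'|exists D'].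
Qed.

Lemma overlay_full_rooted : full_rooted_subtree Omega ch (T `|` S).
Proof.
have [[Tc TO upT] fT] := frT; have [[Sc _ upS] fS] := frS.
split; last first.
  by move=> D; rewrite overlay_inner => -[/fT|/fS] h D' /h; [left|right].
split; [by move=> D [/Tc|/Sc]|by left|].
by move=> D D' cD chD [/(upT _ _ cD chD)|/(upS _ _ cD chD)]; [left|right].
Qed.

Lemma overlay_leaf D : leaves ch T D -> ~ inner ch S D ->
  leaves ch (T `|` S) D.
Proof.
move=> lD nS; apply: contrapT => nl.
have : inner ch (T `|` S) D by split=> //; left; exact: leaves_sub lD.
by rewrite overlay_inner => -[/(leaf_not_inner lD)|].
Qed.

(** Subdividing a cell that is interior to S does not change the overlay. *)
Lemma overlay_grow s : grow T s `|` S = grow (T `|` S) (s `\` inner ch S).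
Proof.
have [_ fS] := frS.
apply/seteqP; split=> D.
  case=> [[TD|[P sP chP]]|SD]; [by left; left| |by left; right].
  have [iP|niP] := pselect (inner ch S P); first by left; right; exact: fS iP _ chP.
  by right; exists P.
case=> [[TD|SD]|[P [sP _] chP]]; [by left; left|by right|].
by left; right; exists P.
Qed.

End Overlay.
End Subdivision.

(** * Conforming trees grown by patch subdivisions *)

Section Patches.
Context {C : choiceType} (Omega : C) (ch : C -> set C) (conf : set (set C)).
Context (tree_ch : tree_axioms Omega ch).
Context (ch_finite : forall D, cell Omega ch D -> finite_set (ch D)).
Context (ch_nonempty : forall D, cell Omega ch D -> ch D !=set0).
Context (root_conforming : conforming_tree Omega ch conf [set Omega]).
Context (uniq_patches : unique_patches Omega ch conf).
Implicit Types (S T s : set C) (D P : C) (N m : nat).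

(** The number of steps is the number of patches, by [grown_tree_size]. *)
Inductive grown : nat -> set C -> Prop :=
| grown_root : grown 0 [set Omega]
| grown_grow N T s : grown N T -> subdivision_patch ch conf s ->
    s `<=` leaves ch T -> grown N.+1 (grow ch T s).

Definition patches_in (A : set C) : set (set C) :=
  [set s | subdivision_patch ch conf s /\ s `<=` A].

Lemma grown_conforming N T : grown N T -> conforming_tree Omega ch conf T.
Proof.
elim=> // {}N {}T s _ [frT confT] ps sT; split.
  exact: grow_full_rooted.
rewrite (grow_leaves tree_ch ch_nonempty frT sT).
by case: ps => _ _ iso _; exact: iso.
Qed.

Lemma grown_full_rooted N T : grown N T -> full_rooted_subtree Omega ch T.
Proof. by move=> /grown_conforming[]. Qed.

Lemma grown_finite N T : grown N T -> finite_set T.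
Proof.
elim=> [|{}N {}T s gT fT _ sT]; first exact: finite_set1.
exact: (grow_finite ch_finite (grown_full_rooted gT)).
Qed.

Lemma inner_root : inner ch [set Omega] = set0.
Proof.
apply/seteqP; split=> // D /innerP[/= -> [D' chD E]].
by case: tree_ch => /(_ _ (cell_root _ _)); rewrite -{2}E.
Qed.

Lemma patches_in_set0 : patches_in set0 = set0.
Proof.
by apply/seteqP; split=> // s [[[D sD] _ _ _] /(_ _ sD)].
Qed.

(** A patch meeting [s] equals [s], by uniqueness of the patch of a cell; a
    patch not meeting [s] was inside the old tree already. *)
Lemma patches_in_grow T s : full_rooted_subtree Omega ch T ->
  subdivision_patch ch conf s -> s `<=` leaves ch T ->
  patches_in (inner ch (grow ch T s)) = patches_in (inner ch T) `|` [set s].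
Proof.
move=> frT ps sT; rewrite (grow_inner tree_ch ch_nonempty frT sT).
apply/seteqP; split=> p; last first.
  by case=> [[pp pT]|->]; split=> // D /pT; left.
case=> pp psub.
have [[D [pD sD]]|dis] := pselect (exists D, p D /\ s D).
  have [q [_ uq]] := uniq_patches (patch_cell frT sT sD).
  by right; rewrite /= -(uq p) // (uq s).
left; split=> // D pD; case: (psub _ pD) => // sD.
by case: dis; exists D.
Qed.

Lemma patch_not_inner T s : subdivision_patch ch conf s -> s `<=` leaves ch T ->
  ~ patches_in (inner ch T) s.
Proof.
move=> [[D sD] _ _ _] sT [_ /(_ _ sD)]; apply: leaf_not_inner.
exact: sT.
Qed.

Lemma grown_patches N T : grown N T ->
  finite_set (patches_in (inner ch T)) /\
  #|` fset_set (patches_in (inner ch T))| = N.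
Proof.
elim=> [|{}N {}T s gT [fP cP] ps sT].
  by rewrite inner_root patches_in_set0 fset_set0 cardfs0.
have f1 : finite_set [set s] by exact: finite_set1.
rewrite (patches_in_grow (grown_full_rooted gT) ps sT); split.
  by rewrite finite_setU.
rewrite card_disjoint_union//; first by rewrite fset_set1 cardfs1 cP addn1.
by move=> p [pT /= E]; apply: (patch_not_inner ps sT); rewrite -E.
Qed.

Lemma grown_tree_size (R : realType) N T : grown N T ->
  tree_size ch conf R T = (N%:R)%:E.
Proof.
by move=> /grown_patches[fP cP]; rewrite /tree_size /counting asboolT // cP.
Qed.

(** Each step makes one patch interior, of at most Theta cells. *)
Lemma grown_inner_card (R : realType) Theta N T :
  is_max_patch_size Omega ch conf R Theta -> grown N T ->
  (#|` fset_set (inner ch T)| <= Theta * N)%N.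
Proof.
move=> [le_Theta _]; elim=> [|{}N {}T s gT IH ps sT].
  by rewrite inner_root fset_set0 cardfs0.
have frT := grown_full_rooted gT; have fT := grown_finite gT.
rewrite (grow_inner tree_ch ch_nonempty frT sT).
have [[D sD] _ _ _] := ps; have cD := patch_cell frT sT sD.
have sE : patch_of ch conf D = s.
  rewrite /patch_of; case: xgetP => [p _ [pp pD]|/(_ s)[]//].
  by have [q [_ uq]] := uniq_patches cD; rewrite -(uq p) // (uq s).
have [fs cs] := counting_le_nat (le_Theta _ cD); rewrite sE in fs cs.
have fI := inner_finite ch fT.
apply: (leq_trans (card_union fI fs)).
by rewrite mulnS addnC leq_add.
Qed.

Context (nec_patches : necessary_patches Omega ch conf).

(** Stopping criterion for growing T inside S: descending from the root, a
    cell of S whose parent is in T is in T, for otherwise the parent would be a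
    leaf of T subdivided in S. *)
Lemma exhausted_subtree_eq S T : full_rooted_subtree Omega ch S ->
  full_rooted_subtree Omega ch T -> T `<=` S ->
  (forall D, leaves ch T D -> ~ inner ch S D) -> S = T.
Proof.
move=> [[Sc _ upS] _] [[_ TO _] fT] TS stuck.
apply/seteqP; split=> // D SD; have cD := Sc _ SD; elim: cD SD => // P P' cP IH chP SP'.
have SP := upS _ _ cP chP SP'; have TP := IH SP.
suff iP : inner ch T P by exact: fT iP _ chP.
split=> // lP; apply: (stuck _ lP).
by apply/innerP; split=> //; exists P'.
Qed.

(** As long as T inside S is not S, some leaf of T is interior to S; a patch
    necessary for it is subdivided in S, so T can grow without leaving S. *)
Lemma grown_or_below S m : conforming_tree Omega ch conf S ->
  (exists2 j, (j < m)%N & grown j S) \/ (exists2 T, grown m T & T `<=` S).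
Proof.
move=> cS; have [frS _] := cS.
elim: m => [|m [[j jm gS]|[T gT TS]]].
- right; exists [set Omega]; first exact: grown_root.
  by move=> _ ->; case: frS => -[].
- by left; exists j => //; exact: ltnW.
have [[D lD iD]|stuck] := pselect (exists2 D, leaves ch T D & inner ch S D).
  right; have [s [ps sT nec]] := nec_patches (grown_conforming gT) lD.
  exists (grow ch T s); first exact: grown_grow.
  move=> P [/TS//|[Q sQ chQ]]; case: frS => _ fS.
  exact: fS (nec _ cS iD _ sQ) _ chQ.
left; exists m => //; rewrite (exhausted_subtree_eq frS (grown_full_rooted gT) TS)//.
by move=> D lD iD; apply: stuck; exists D.
Qed.

(** Growing inside S beyond m steps would produce more than m patches of S. *)
Lemma conforming_grown (R : realType) S m : conforming_tree Omega ch conf S ->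
  (tree_size ch conf R S <= m%:R%:E)%E -> exists2 j, (j <= m)%N & grown j S.
Proof.
move=> cS size_S.
have [[j jm gS]|[T gT TS]] := grown_or_below m.+1 cS; first by exists j.
have [fS cardS] := counting_le_nat size_S.
have [fT cardT] := grown_patches gT.
have : (m.+1 <= m)%N; last by rewrite ltnn.
rewrite -{1}cardT; apply: leq_trans cardS; apply: card_subset => // s [ps sT].
by split=> // D /sT; exact: inner_mono.
Qed.

End Patches.

(** * Runs of the algorithm over the reals *)

Section Runs.
Context {C : choiceType} (Omega : C) (ch : C -> set C) (conf : set (set C)).
Context (tree_ch : tree_axioms Omega ch).
Context (ch_finite : forall D, cell Omega ch D -> finite_set (ch D)).
Context (ch_nonempty : forall D, cell Omega ch D -> ch D !=set0).
Context (root_conforming : conforming_tree Omega ch conf [set Omega]).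
Context (uniq_patches : unique_patches Omega ch conf).
Context {R : realType} (e : C -> R).
Context (e_ge0 : forall D, cell Omega ch D -> 0 <= e D).
Context (e_sub : subadditive_errors Omega ch e).
Implicit Types (S T s A : set C) (D P : C) (N M m : nat) (v w : C -> R).

Lemma child_error_le D D' : cell Omega ch D -> ch D D' -> e D' <= e D.
Proof.
move=> cD chD; apply: le_trans (e_sub cD); rewrite (fsbigD1 D')//=; last first.
  exact: ch_finite.
rewrite lerDl; apply: fsumr_ge0 => P [chP _].
exact: e_ge0 (cell_child cD chP).
Qed.

(** The values of nu after marking D and before the subdivision. *)
Definition mark v D P : R := v P + (if P == D then (e D)^-1 else 0).

(** The iterations of the algorithm with real-valued nu, extended by 0 outside
    of the tree (see [run_outside]), so that nu also makes sense on the leaves of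
    an overlay.  As the modified error mu equals e / (1 + e nu), it is left
    implicit, and its maximality at the marked cell is stated without
    division. *)
Inductive run : nat -> set C -> (C -> R) -> Prop :=
| run_init : run 0 [set Omega] (fun=> 0)
| run_step N T v w D s : run N T v -> leaves ch T D -> 0 < e D ->
    (forall P, leaves ch T P ->
       e P * (1 + e D * v D) <= e D * (1 + e P * v P)) ->
    subdivision_patch ch conf s -> s `<=` leaves ch T ->
    necessary Omega ch conf s D ->
    (forall P, ~ (\bigcup_(Q in s) ch Q) P -> w P = mark v D P) ->
    (forall P P', s P -> ch P P' -> w P' = mark v D P) ->
    run N.+1 (grow ch T s) w.

Lemma run_grown N T v : run N T v -> grown Omega ch conf N T.
Proof.
elim=> [|{}N {}T {}v w D s _ gT _ _ _ ps sT _ _ _]; first exact: grown_root.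
exact: grown_grow.
Qed.

Lemma mark_ge v D P : 0 < e D -> v P <= mark v D P.
Proof.
by move=> eD; rewrite /mark lerDl; case: ifP => // _; rewrite invr_ge0 ltW.
Qed.

Lemma run_ge0 N T v P : run N T v -> 0 <= v P.
Proof.
move=> r; elim: r P => [P|{}N {}T {}v w D s _ v0 _ eD _ _ _ _ wold wnew P]; first exact: lexx.
have m0 Q : 0 <= mark v D Q by exact: le_trans (v0 Q) (mark_ge _ _ eD).
have [[Q sQ chQ]|nP] := pselect ((\bigcup_(Q in s) ch Q) P).
  by rewrite (wnew _ _ sQ chQ).
by rewrite wold.
Qed.

Lemma run_outside N T v P : run N T v -> ~ T P -> v P = 0.
Proof.
move=> r; elim: r P => // {}N {}T {}v w D s _ v0 lD _ _ _ _ _ wold _ P.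
move=> /not_orP[nT nP]; rewrite wold// /mark v0// add0r.
by case: eqP => // E; case: nT; rewrite E; exact: leaves_sub lD.
Qed.

(** Marking a cell D adds e(D) / e(D) = 1 to a sum of e nu over a set
    containing D. *)
Lemma sum_mark A (a : C -> R) (c : R) v D : finite_set A -> 0 < e D ->
  \sum_(P \in A) (a P + c * (e P * mark v D P)) =
  \sum_(P \in A) (a P + c * (e P * v P)) + c * (D \in A)%:R.
Proof.
move=> fA eD; rewrite (eq_fsbigr (fun P =>
  (a P + c * (e P * v P)) + c * (P == D)%:R)); last first.
  move=> P _; rewrite /mark; case: eqP => [->|_]; last by rewrite addr0 mulr0 addr0.
  by rewrite mulrDr mulfV ?gt_eqF// mulrDr addrA.
rewrite fsbig_split//; congr (_ + _).
have [DA|DA] := boolP (D \in A).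
  rewrite (fsbigD1 D)//; last by rewrite inE in DA.
  rewrite /= eqxx fsbig1 ?addr0// => P [_ /= /eqP/negbTE ->].
  by rewrite mulr0.
rewrite mulr0; apply: fsbig1 => P AP; case: eqP => [E|_]; last by rewrite mulr0.
by move: DA; rewrite -E mem_set.
Qed.

Lemma sum_subdivide A s (f g : C -> R) : finite_set A ->
  (forall P, A P -> cell Omega ch P) -> s `<=` A ->
  (forall P P', s P -> ch P P' -> 0 <= g P') ->
  (forall P, A P -> ~ s P -> g P <= f P) ->
  (forall P, s P -> \sum_(P' \in ch P) g P' <= f P) ->
  \sum_(P \in subdivide ch A s) g P <= \sum_(P \in A) f P.
Proof.
move=> fA cA sA g0 gf gs.
have fs : finite_set s by exact: sub_finite_set fA.
have fch P : s P -> finite_set (ch P) by move=> /sA/cA/ch_finite.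
have fAs : finite_set (A `\` s) by exact: finite_setD.
apply: le_trans (fsum_union_le fAs _ _) _.
- exact: bigcup_finite.
- by move=> P' [P sP chP]; exact: g0 chP.
rewrite -[in leRHS](setDUK sA) setUC fsbigU0//; last by move=> P [[_]].
apply: lerD; first by apply: fsum_le => // P [AP nP]; exact: gf.
apply: le_trans (fsum_bigcup_le fs fch g0) _.
exact: fsum_le.
Qed.

(** The modified error a / (1 + a v) increases with the error a and decreases
    with v.  For a > 0 it is the inverse of 1/a + v. *)
Lemma modified_error_mono (t a b v w : R) : 0 <= t -> 0 <= a -> a <= b -> 0 <= v ->
  v <= w -> t * (1 + a * w) <= a -> t * (1 + b * v) <= b.
Proof.
move=> t0 a0 ab v0 vw H.
have [a_gt0|] := ltP 0 a; last first.
  move=> a_le0; have aE : a = 0 by apply/eqP; rewrite eq_le a_le0.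
  have tE : t = 0 by apply/eqP; rewrite eq_le t0 andbT; rewrite aE mul0r addr0 mulr1 in H.
  by rewrite tE mul0r (le_trans a0).
rewrite -(ler_pM2l a_gt0).
have h1 : t * (b * v) <= t * (b * w).
  by do 2 apply: ler_wpM2l => //; exact: le_trans ab.
have h2 : b * (t * (1 + a * w)) <= b * a by apply: ler_wpM2l => //; exact: le_trans ab.
have h3 : a * t <= b * t by exact: ler_wpM2r.
have h4 : a * (t * (b * v)) <= a * (t * (b * w)) by exact: ler_wpM2l.
lra.
Qed.

(** That is, t is nonnegative and at most the maximum of mu over the leaves. *)
Definition below_threshold T v t : Prop :=
  0 <= t /\ exists2 P, leaves ch T P & t * (1 + e P * v P) <= e P.

Lemma below_threshold_marked T v D t : (forall P, 0 <= v P) -> 0 < e D ->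
  (forall P, T P -> 0 <= e P) ->
  (forall P, leaves ch T P -> e P * (1 + e D * v D) <= e D * (1 + e P * v P)) ->
  below_threshold T v t -> t * (1 + e D * v D) <= e D.
Proof.
move=> v0 eD eT maxD [t0 [P lP tP]].
have eP : 0 <= e P by apply: eT; exact: leaves_sub lP.
have pos : 0 < 1 + e P * v P by rewrite ltr_wpDr// mulr_ge0.
have pos' : 0 <= 1 + e D * v D by rewrite addr_ge0// mulr_ge0// ltW.
rewrite -(ler_pM2r pos); apply: le_trans (maxD _ lP).
by rewrite mulrAC ler_wpM2r.
Qed.

Section Step.
Context (N : nat) (T : set C) (v w : C -> R) (D : C) (s : set C).
Context (rT : run N T v) (lD : leaves ch T D) (eD : 0 < e D).
Context (maxD : forall P, leaves ch T P ->
  e P * (1 + e D * v D) <= e D * (1 + e P * v P)).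
Context (sT : s `<=` leaves ch T).
Context (wold : forall P, ~ (\bigcup_(Q in s) ch Q) P -> w P = mark v D P).
Context (wnew : forall P P', s P -> ch P P' -> w P' = mark v D P).

Let gT : grown Omega ch conf N T. Proof. exact: run_grown rT. Qed.
Let frT : full_rooted_subtree Omega ch T.
Proof. exact: grown_full_rooted gT. Qed.
Let cT P : T P -> cell Omega ch P. Proof. exact: subtree_cell. Qed.
Let v0 P : 0 <= v P. Proof. exact: run_ge0 rT. Qed.

Lemma old_cell_not_new P : T P -> ~ (\bigcup_(Q in s) ch Q) P.
Proof. by move=> TP [Q sQ chQ]; exact: (new_child sT sQ chQ). Qed.

(** A child has at most the error and at least the nu of its parent, so its
    modified error is at most that of the parent. *)
Lemma threshold_decreases t : below_threshold (grow ch T s) w t -> below_threshold T v t.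
Proof.
move=> [t0 [P lP tP]]; split=> //; move: lP.
rewrite (grow_leaves tree_ch ch_nonempty frT sT) => -[[lP nP]|[Q sQ chQ]].
  exists P => //; apply: modified_error_mono tP => //.
  - by apply/e_ge0/cT; exact: leaves_sub lP.
  - rewrite wold; first exact: mark_ge.
    by apply: old_cell_not_new; exact: leaves_sub lP.
exists Q; first exact: sT.
have cQ := patch_cell frT sT sQ.
apply: modified_error_mono tP => //.
- exact: e_ge0 (cell_child cQ chQ).
- exact: child_error_le.
- by rewrite (wnew sQ chQ) mark_ge.
Qed.

Lemma nu_bound_marked t : below_threshold T v t ->
  (forall P, leaves ch T P -> t * v P <= 1) ->
  (forall P, leaves ch T P -> t * mark v D P <= 1).
Proof.
move=> lt bound P lP; have := below_threshold_marked v0 eD _ maxD lt.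
move=> /(_ (fun P TP => e_ge0 (cT TP))) tD.
rewrite /mark; case: eqP => [->|_]; last by rewrite addr0; exact: bound.
rewrite -(ler_pM2r eD) mul1r -mulrA mulrDl mulVf ?gt_eqF//.
by rewrite [v D * _]mulrC addrC.
Qed.

Section StepBudget.
Context (S : set C) (frS : full_rooted_subtree Omega ch S) (fS : finite_set S).

Let w_old P : T P -> w P = mark v D P.
Proof. exact: (fun TP => wold (old_cell_not_new TP)). Qed.

Let sum_children P : s P -> \sum_(P' \in ch P) e P' <= e P.
Proof. move=> sP; exact: (e_sub (patch_cell frT sT sP)). Qed.

Let mark0 P : 0 <= mark v D P.
Proof. exact: le_trans (v0 P) (mark_ge _ _ eD). Qed.

(** A child that is interior to S has its parent interior to S, so the sum only
    sees subdivisions of cells that it already counts; children that leave the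
    interior of S are dropped.  The growth by 1 is the marking of D. *)
Lemma inside_sum_step :
  \sum_(P \in leaves ch (grow ch T s) `&` inner ch S) (e P * w P) <=
  \sum_(P \in leaves ch T `&` inner ch S) (e P * v P) + (D \in inner ch S)%:R.
Proof.
have [[_ _ upS] _] := frS.
have fT := grown_finite tree_ch ch_finite ch_nonempty root_conforming gT.
set A := leaves ch T `&` inner ch S.
have fA : finite_set A by apply: finite_setIl; exact: leaves_finite.
have cA P : A P -> cell Omega ch P by move=> [/leaves_sub/cT].
have sA : s `&` inner ch S `<=` A by move=> P [/sT lP iP].
have new0 P P' : (s `&` inner ch S) P -> ch P P' -> 0 <= e P' * w P'.
  move=> [sP _] chP; rewrite (wnew sP chP) mulr_ge0//.
  exact: e_ge0 (cell_child (patch_cell frT sT sP) chP).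
have -> : (D \in inner ch S) = (D \in A).
  by apply/idP/idP; rewrite !inE; [split|case].
have := sum_mark (fun=> 0) 1 v fA eD.
under eq_fsbigr do rewrite add0r mul1r.
under [X in _ = X + _]eq_fsbigr do rewrite add0r mul1r.
rewrite mul1r => <-.
apply: le_trans (sum_subdivide fA cA sA new0 _ _); last 2 first.
- by move=> P [lP _] _; rewrite w_old//; exact: leaves_sub lP.
- move=> P [sP _]; rewrite (eq_fsbigr (fun P' => e P' * mark v D P)).
    by rewrite -mulr_fsuml ler_wpM2r// sum_children.
  by move=> P'; rewrite inE => chP; rewrite (wnew sP chP).
apply: fsum_subset.
- rewrite /subdivide finite_setU; split; first exact: finite_setD.
  apply: bigcup_finite; first exact: sub_finite_set sA fA.
  by move=> P [sP _]; exact: ch_finite (patch_cell frT sT sP).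
- rewrite (grow_leaves tree_ch ch_nonempty frT sT).
  move=> P [[[lP nP]|[Q sQ chQ]] iP]; first by left; split=> // -[].
  right; exists Q => //; split=> //; apply/innerP; split; last first.
    by exists P => //; exact: inner_sub iP.
  exact: upS (patch_cell frT sT sQ) chQ (inner_sub iP).
- move=> P [[AP _]|[Q sQ chQ]]; last exact: new0 sQ chQ.
  rewrite w_old ?mulr_ge0//; first exact/e_ge0/cA.
  by case: AP => /leaves_sub.
Qed.

(** Subdividing a cell interior to S does not change the overlay, but children
    that are leaves of S then enter T, which raises nu from 0 and lowers the
    weight e (1 - t nu).  For the other cells subadditivity applies, because
    1 - t nu is nonnegative. *)
Lemma overlay_sum_step (t : R) : 0 <= t ->
  (forall P, leaves ch T P -> t * mark v D P <= 1) ->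
  (forall P, 0 <= w P) ->
  t * (D \notin inner ch S)%:R +
    \sum_(P \in leaves ch (grow ch T s `|` S)) (e P + - t * (e P * w P)) <=
  \sum_(P \in leaves ch (T `|` S)) (e P + - t * (e P * v P)).
Proof.
move=> t0 bound w0.
have fT := grown_finite tree_ch ch_finite ch_nonempty root_conforming gT.
have frU := overlay_full_rooted frS frT.
set A := leaves ch (T `|` S).
have fA : finite_set A by apply: leaves_finite; rewrite finite_setU.
have cA P : A P -> cell Omega ch P by move=> /leaves_sub; exact: subtree_cell frU P.
have sA : s `\` inner ch S `<=` A.
  by move=> P [/sT lP iP]; exact: (overlay_leaf frS frT).
have -> : (D \notin inner ch S) = (D \in A).
  apply/idP/idP; rewrite notin_setE inE; first exact: (overlay_leaf frS frT).
  move=> /leaf_not_inner; rewrite (overlay_inner frS frT) => nI iS.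
  by apply: nI; right.
have := sum_mark e (- t) v fA eD.
move=> /eqP; rewrite mulNr -subr_eq opprK addrC => /eqP <-; rewrite lerD2l.
rewrite (overlay_grow _ frS).
rewrite (grow_leaves tree_ch ch_nonempty frU sA).
have weight P : e P + - t * (e P * mark v D P) = e P * (1 - t * mark v D P).
  by ring.
apply: (sum_subdivide fA cA sA).
- move=> P P' [sP _] chP; rewrite (wnew sP chP).
  rewrite (_ : _ + _ = e P' * (1 - t * mark v D P)); last by ring.
  rewrite mulr_ge0 ?subr_ge0 ?bound//; last exact: sT.
  exact: e_ge0 (cell_child (patch_cell frT sT sP) chP).
- move=> P AP nP; rewrite lerD2l !mulNr lerN2; apply: ler_wpM2l => //.
  apply: ler_wpM2l; first exact/e_ge0/cA.
  have [TP|nT] := pselect (T P); first by rewrite w_old.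
  rewrite /mark (run_outside rT nT) add0r; case: eqP => // E.
  by case: nT; rewrite E; exact: leaves_sub lD.
move=> P [sP _]; rewrite weight.
rewrite (eq_fsbigr (fun P' => e P' * (1 - t * mark v D P))).
  by rewrite -mulr_fsuml ler_wpM2r ?sum_children// subr_ge0 bound//; exact: sT.
by move=> P'; rewrite inE => chP; rewrite (wnew sP chP); ring.
Qed.

End StepBudget.

End Step.

(** When D is marked, nu(D) becomes the inverse of the threshold, and no
    later threshold is larger. *)
Lemma nu_bound N T v : run N T v -> forall t : R, below_threshold T v t ->
  forall P, leaves ch T P -> t * v P <= 1.
Proof.
elim=> [t _ P _|{}N {}T {}v w D s rT IH lD eD maxD ps sT nec wold wnew t lt P].
  by rewrite mulr0.
have lt' := threshold_decreases rT eD sT wold wnew lt.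
have bound := nu_bound_marked rT eD maxD lt' (IH _ lt').
have frT := grown_full_rooted tree_ch ch_nonempty root_conforming (run_grown rT).
rewrite (grow_leaves tree_ch ch_nonempty frT sT) => -[[lP nP]|[Q sQ chQ]].
  rewrite wold; first exact: bound.
  by move=> [Q sQ chQ]; apply: (new_child sT sQ chQ); exact: leaves_sub lP.
by rewrite (wnew _ _ sQ chQ); exact/bound/sT.
Qed.

Section Budget.
Context (S : set C) (cS : conforming_tree Omega ch conf S) (fS : finite_set S).
Context (fpS : finite_set (patches_in ch conf (inner ch S))).

Let frS : full_rooted_subtree Omega ch S. Proof. by case: cS. Qed.

(** Here M counts the markings of cells interior to S.  Each of them
    subdivides a patch of S by necessity, which bounds M both by a number of
    patches and by a number of cells. *)
Lemma run_budget N T v : run N T v -> exists M, [/\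
  (M <= N)%N,
  (M <= #|` fset_set (patches_in ch conf (inner ch T `&` inner ch S))|)%N,
  (M <= #|` fset_set (inner ch T `&` inner ch S)|)%N,
  \sum_(P \in leaves ch T `&` inner ch S) (e P * v P) <= M%:R &
  forall t : R, below_threshold T v t ->
    t * (N - M)%:R +
      \sum_(P \in leaves ch (T `|` S)) (e P + - t * (e P * v P)) <=
    \sum_(P \in leaves ch S) e P].
Proof.
elim=> [|{}N {}T {}v w D s rT [M [MN Mp Mi Mv Mt]] lD eD maxD ps sT nec wold wnew].
  exists 0%N; split=> //.
    by rewrite fsbig1// => P _; rewrite mulr0.
  move=> t _; rewrite subnn mulr0 add0r.
  rewrite (_ : _ `|` S = S); last by apply/setUidr => _ ->; case: frS => -[].
  by under eq_fsbigr do rewrite !mulr0 addr0.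
have gT := run_grown rT.
have frT := grown_full_rooted tree_ch ch_nonempty root_conforming gT.
have r' := run_step rT lD eD maxD ps sT nec wold wnew.
have T'E := grow_inner tree_ch ch_nonempty frT sT.
have w0 P := run_ge0 P r'.
have in_step := inside_sum_step rT lD eD sT wold wnew frS.
have up_step t := overlay_sum_step rT lD eD sT wold wnew frS fS.
have subI : inner ch T `&` inner ch S `<=` inner ch (grow ch T s) `&` inner ch S.
  by move=> P [iT iS]; split=> //; rewrite T'E; left.
have subP : patches_in ch conf (inner ch T `&` inner ch S) `<=`
    patches_in ch conf (inner ch (grow ch T s) `&` inner ch S).
  by move=> p [pp pI]; split=> // P /pI/subI.
have fI : finite_set (inner ch (grow ch T s) `&` inner ch S).
  by apply: finite_setIr; exact: inner_finite.
have fP : finite_set (patches_in ch conf (inner ch (grow ch T s) `&` inner ch S)).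
  by apply: sub_finite_set fpS => p [pp pI]; split=> // P /pI[].
exists (M + (D \in inner ch S))%N; split.
- by rewrite -addn1 leq_add// leq_b1.
- have [iD|_] := boolP (D \in inner ch S); last first.
    by rewrite addn0; apply: leq_trans Mp _; exact: card_subset.
  rewrite inE in iD; have sI := nec _ cS iD.
  rewrite addn1; apply: leq_ltn_trans Mp _; apply: (card_subset_lt fP subP (x := s)).
    by split=> // P sP; split; [rewrite T'E; right|exact: sI].
  by move=> [_ sIT]; apply: (patch_not_inner ps sT); split=> // P /sIT[].
- have [iD|_] := boolP (D \in inner ch S); last first.
    by rewrite addn0; apply: leq_trans Mi _; exact: card_subset.
  rewrite inE in iD; have sI := nec _ cS iD.
  have [[Q sQ] _ _ _] := ps.
  rewrite addn1; apply: leq_ltn_trans Mi _; apply: (card_subset_lt fI subI (x := Q)).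
    by split; [rewrite T'E; right|exact: sI].
  by move=> [iQ _]; exact: leaf_not_inner (sT _ sQ) iQ.
- by rewrite natrD; apply: le_trans in_step _; rewrite lerD2r.
move=> t lt; have [t0 _] := lt.
have lt' := threshold_decreases rT eD sT wold wnew lt.
have bound := nu_bound_marked rT eD maxD lt' (nu_bound rT lt').
apply: le_trans (Mt _ lt').
have -> : (N.+1 - (M + (D \in inner ch S)) = (N - M) + (D \notin inner ch S))%N.
  by case: (D \in _) => /=; rewrite ?addn0 ?addn1 ?subSS// subSn.
rewrite natrD mulrDr -addrA lerD2l.
exact: up_step t0 bound w0.
Qed.

End Budget.

Context (nec_patches : necessary_patches Omega ch conf).
Context (Theta : nat) (max_patch : is_max_patch_size Omega ch conf R Theta).

Lemma overlay_weight_ge0 S N T v t P : run N T v -> conforming_tree Omega ch conf S ->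
  below_threshold T v t -> leaves ch (T `|` S) P -> 0 <= e P + - t * (e P * v P).
Proof.
move=> rT [frS _] lt lP.
have frT := grown_full_rooted tree_ch ch_nonempty root_conforming (run_grown rT).
have cP := subtree_cell (overlay_full_rooted frS frT) (leaves_sub lP).
have [TP|nT] := pselect (T P); last first.
  by rewrite (run_outside rT nT) !mulr0 addr0 e_ge0.
rewrite (_ : _ + _ = e P * (1 - t * v P)); last by ring.
rewrite mulr_ge0 ?e_ge0// subr_ge0; apply: (nu_bound rT lt).
apply: contrapT => nl; apply: (leaf_not_inner lP).
by rewrite (overlay_inner frS frT); left; split.
Qed.

(** The leaf D that attains the threshold acts as one more marking; this
    accounts for the + 1 in N + 1 - m. *)
Lemma threshold_lower_bound N T v S m D t : run N T v ->
  grown Omega ch conf m S -> leaves ch T D -> 0 < t ->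
  t * (1 + e D * v D) = e D ->
  exists M, [/\ t * (N.+1 - m)%:R <= \sum_(P \in leaves ch S) e P,
   (M <= #|` fset_set (inner ch T `&` inner ch S)|)%N &
   \sum_(P \in leaves ch T `&` inner ch S) (e P * v P) <= M%:R].
Proof.
move=> rT gS lD t_gt0 tD.
have gT := run_grown rT.
have cS := grown_conforming tree_ch ch_nonempty root_conforming gS.
have cT := grown_conforming tree_ch ch_nonempty root_conforming gT.
have [[frS _] [frT _]] := (cS, cT).
have fS := grown_finite tree_ch ch_finite ch_nonempty root_conforming gS.
have fT := grown_finite tree_ch ch_finite ch_nonempty root_conforming gT.
have [fpS cpS] := grown_patches tree_ch ch_nonempty root_conforming uniq_patches gS.
have lt : below_threshold T v t by split; [exact: ltW|exists D; rewrite ?tD].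
have [M [MN Mp Mi Mv Mt]] := run_budget cS fS fpS rT.
have subP : patches_in ch conf (inner ch T `&` inner ch S) `<=`
    patches_in ch conf (inner ch S).
  by move=> p [pp pI]; split=> // P /pI[].
exists M; split=> //; apply: le_trans (Mt _ lt).
set U := \sum_(P \in leaves ch (T `|` S)) _.
have fU : finite_set (leaves ch (T `|` S)).
  by apply: leaves_finite; rewrite finite_setU.
have U0 : 0 <= U by apply: fsumr_ge0 => P; exact: (overlay_weight_ge0 rT cS lt).
have [iD|nD] := pselect (inner ch S D).
  have [s [ps sT nec]] := nec_patches cT lD.
  have Mm : (M < m)%N.
    rewrite -cpS; apply: leq_ltn_trans Mp _.
    apply: (card_subset_lt fpS subP (x := s)); first by split=> //; exact: nec.
    by move=> [_ sIT]; apply: (patch_not_inner ps sT); split=> // P /sIT[].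
  apply: (@le_trans _ _ (t * (N - M)%:R)); last by rewrite lerDl.
  by rewrite ler_pM2l// ler_nat -(subSS M N) leq_sub2l.
have Mm : (M <= m)%N by rewrite -cpS; apply: leq_trans Mp _; exact: card_subset.
have tU : t <= U.
  have lU : leaves ch (T `|` S) D by exact: (overlay_leaf frS frT).
  rewrite /U (fsbigD1 D)//=.
  rewrite (_ : e D + _ = t); last by move: tD => /esym tD; lra.
  by rewrite lerDl; apply: fsumr_ge0 => P [lP _]; exact: (overlay_weight_ge0 rT cS lt lP).
apply: (@le_trans _ _ (t * (N - M).+1%:R)).
  by rewrite ler_pM2l// ler_nat -subSn// leq_sub2l.
by rewrite -natr1 mulrDr mulr1 lerD2l.
Qed.

(** The estimate of the theorem, for one comparison tree and with the
    denominator cleared. *)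
Lemma run_near_best N T v S m : run N T v -> grown Omega ch conf m S ->
  (m <= N)%N ->
  (\sum_(P \in leaves ch T) e P) * (N.+1 - m)%:R <=
  (N.+1 - m + Theta * m)%:R * \sum_(P \in leaves ch S) e P.
Proof.
move=> rT gS mN.
have gT := run_grown rT.
have cS := grown_conforming tree_ch ch_nonempty root_conforming gS.
have cT := grown_conforming tree_ch ch_nonempty root_conforming gT.
have [[frS _] [frT _]] := (cS, cT).
have fS := grown_finite tree_ch ch_finite ch_nonempty root_conforming gS.
have fT := grown_finite tree_ch ch_finite ch_nonempty root_conforming gT.
have flT := leaves_finite ch fT.
have eT P : leaves ch T P -> 0 <= e P.
  by move=> /leaves_sub/(subtree_cell frT)/e_ge0.
have den P : leaves ch T P -> 0 < 1 + e P * v P.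
  by move=> lP; rewrite ltr_wpDr// mulr_ge0 ?eT// (run_ge0 _ rT).
have ES0 : 0 <= \sum_(P \in leaves ch S) e P.
  by apply: fsumr_ge0 => P /leaves_sub/(subtree_cell frS)/e_ge0.
have [[D lD eD]|noD] := pselect (exists2 D, leaves ch T D & 0 < e D); last first.
  rewrite fsbig1 ?mul0r ?mulr_ge0// => P lP.
  apply/eqP; rewrite eq_le eT// andbT leNgt; apply/negP => eP.
  by apply: noD; exists P.
(* B attains the threshold t, which is positive because of D. *)
have [B lB maxB] := finite_max (fun P => e P / (1 + e P * v P)) flT lD.
set t := e B / (1 + e B * v B) in maxB.
have t_gt0 : 0 < t by apply: lt_le_trans (maxB _ lD); rewrite divr_gt0// den.
have tB : t * (1 + e B * v B) = e B by rewrite divfK// gt_eqF// den.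
have le_t P : leaves ch T P -> e P <= t * (1 + e P * v P).
  by move=> lP; rewrite -ler_pdivrMr ?den// maxB.
clearbody t.
have [M [tS Mi Mv]] := threshold_lower_bound rT gS lB t_gt0 tB.
have [fpS _] := grown_patches tree_ch ch_nonempty root_conforming uniq_patches gS.
set F := leaves ch T `&` inner ch S.
have fF : finite_set F by exact: finite_setIl.
have inside : \sum_(P \in F) e P <= t * (Theta * m)%:R.
  apply: (@le_trans _ _ (\sum_(P \in F) (t + t * (e P * v P)))).
    by apply: fsum_le => // P [lP _]; have := le_t _ lP; rewrite mulrDr mulr1.
  rewrite fsbig_split//= -mulr_fsumr.
  rewrite [X in X + _]fsbig_finite//= big_const_seq count_predT.
  rewrite iter_addr addr0 -[t *+ _]mulr_natr -mulrDr ler_pM2l//.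
  apply: (@le_trans _ _ (#|` fset_set F| + M)%:R); first by rewrite natrD lerD2l.
  rewrite ler_nat.
  apply: leq_trans (grown_inner_card tree_ch ch_finite ch_nonempty
    root_conforming uniq_patches max_patch gS).
  have fI : finite_set (inner ch T `&` inner ch S).
    by apply: finite_setIl; exact: inner_finite.
  (* M is at most the number of cells interior to both trees; these cells and
     those of F are distinct cells interior to S. *)
  apply: (@leq_trans (#|` fset_set (F `|` (inner ch T `&` inner ch S))|)).
    rewrite card_disjoint_union ?leq_add2l// => P [[lP _] [iP _]].
    exact: leaf_not_inner lP iP.
  by apply: card_subset => [|P [[]|[]]//]; exact: inner_finite.
(* The bound of run_budget at t = 0 says that overlays do not increase the
   error. *)
have outside : \sum_(P \in leaves ch T `\` inner ch S) e P <=
    \sum_(P \in leaves ch S) e P.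
  have [M' [_ _ _ _ /(_ 0)]] := run_budget cS fS fpS rT.
  have l0 : below_threshold T v 0 by split=> //; exists D; rewrite ?mul0r ?ltW.
  move=> /(_ l0); rewrite mul0r add0r; apply: le_trans.
  under [leRHS]eq_fsbigr do rewrite oppr0 mul0r addr0.
  apply: fsum_subset.
  - by apply: leaves_finite; rewrite finite_setU.
  - by move=> P [lP nP]; exact: (overlay_leaf frS frT).
  - move=> P /leaves_sub UP; exact: e_ge0 (subtree_cell (overlay_full_rooted frS frT) UP).
rewrite (fsbigID (inner ch S))//= natrD !mulrDl addrC; apply: lerD.
  by rewrite mulrC ler_wpM2l.
apply: (@le_trans _ _ (t * (Theta * m)%:R * (N.+1 - m)%:R)).
  by rewrite ler_wpM2r.
by rewrite [t * _]mulrC -mulrA ler_wpM2l.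
Qed.

(** With the conventions 1/0 = oo and 1/oo = 0 the formula persists for
    a = 0. *)
Lemma modified_errorE (a b : R) : 0 <= a -> 0 <= b ->
  ((a%:E^-1 + b%:E)^-1 = (a / (1 + a * b))%:E :> \bar R)%E.
Proof.
move=> a0 b0; rewrite inver; case: eqP => [->|/eqP a_neq0].
  by rewrite mul0r addye// invey.
have a_gt0 : 0 < a by rewrite lt_neqAle eq_sym a_neq0.
have d_gt0 : 0 < 1 + a * b by rewrite ltr_wpDr// mulr_ge0.
have E : a^-1 + b = (1 + a * b) / a.
  by rewrite mulrDl mul1r mulrAC mulfV// mul1r.
by rewrite -EFinD inver E gt_eqF ?divr_gt0// invf_div.
Qed.

Lemma reached_run N x : reached Omega ch conf e N x -> exists v,
  [/\ run N (tree x) v, forall P, tree x P -> nu x P = (v P)%:E &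
      forall P, leaves ch (tree x) P -> mu x P = (e P / (1 + e P * v P))%:E].
Proof.
elim=> [{}x [-> nu0 mu0]|{}N {}x y D s _ [v [rv nuv muv]] it].
  exists (fun=> 0); split=> [|P /= ->|P [/= -> _]]; first exact: run_init.
  - by rewrite nu0.
  - by rewrite mu0 mulr0 addr0 divr1.
have [it_gt0 lD mark_max ps sT nec treeE nuD muD nu_ch mu_ch nu_keep mu_keep] := it.
have gT := run_grown rv.
have frT := grown_full_rooted tree_ch ch_nonempty root_conforming gT.
have v0 P : 0 <= v P by exact: run_ge0 rv.
have eT P : tree x P -> 0 <= e P by move=> /(subtree_cell frT)/e_ge0.
have den P : tree x P -> 0 < 1 + e P * v P.
  by move=> TP; rewrite ltr_wpDr// mulr_ge0// eT.
have TD := leaves_sub lD.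
have eD : 0 < e D.
  move: it_gt0; rewrite -mark_max muv// lte_fin pmulr_lgt0 ?invr_gt0//.
  exact: den.
have maxD P : leaves ch (tree x) P ->
    e P * (1 + e D * v D) <= e D * (1 + e P * v P).
  move=> lP; have : (mu x P <= mu x D)%E.
    by rewrite mark_max; apply: ereal_sup_ubound; exists P.
  rewrite !muv// lee_fin ler_pdivrMr ?den//; last exact: leaves_sub lP.
  by rewrite mulrAC ler_pdivlMr ?den.
(* Children of subdivided cells read off nu y; elsewhere w is given by marking,
   which keeps it 0 outside of the tree. *)
pose w P := if `[< (\bigcup_(Q in s) ch Q) P >] then fine (nu y P)
            else mark v D P.
have nu_old P : tree x P -> nu y P = (mark v D P)%:E.
  move=> TP; rewrite /mark; case: eqP => [->|PD].
    by rewrite nuD nuv// inver gt_eqF// -EFinD addrC.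
  by rewrite addr0 nu_keep// nuv.
have w_old P : ~ (\bigcup_(Q in s) ch Q) P -> w P = mark v D P.
  by move=> nP; rewrite /w asboolF.
have w_new P P' : s P -> ch P P' -> w P' = mark v D P.
  move=> sP chP; rewrite /w asboolT; last by exists P.
  by rewrite (nu_ch _ _ sP chP) nu_old//; exact: leaves_sub (sT _ sP).
have not_new P : tree x P -> ~ (\bigcup_(Q in s) ch Q) P.
  by move=> TP [Q sQ chQ]; exact: (new_child sT sQ chQ).
have nu_w P : tree y P -> nu y P = (w P)%:E.
  rewrite treeE => -[TP|[Q sQ chQ]]; first by rewrite w_old ?nu_old//; exact: not_new.
  by rewrite (nu_ch _ _ sQ chQ) (w_new _ _ sQ chQ) nu_old//; exact: leaves_sub (sT _ sQ).
have ry : run N.+1 (tree y) w.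
  by rewrite treeE; apply: (run_step rv lD eD maxD ps sT nec w_old w_new).
exists w; split=> // P lP.
have w0 : 0 <= w P by exact: run_ge0 ry.
have eP : 0 <= e P.
  have fry := grown_full_rooted tree_ch ch_nonempty root_conforming (run_grown ry).
  exact: e_ge0 (subtree_cell fry (leaves_sub lP)).
have nuP := nu_w _ (leaves_sub lP).
rewrite -modified_errorE// -nuP.
move: lP; rewrite treeE (grow_leaves tree_ch ch_nonempty frT sT).
move=> [[lP nP]|[Q sQ chQ]]; last exact: mu_ch sQ chQ.
have [PD|PD] := pselect (P = D); first by rewrite PD in nP *; exact: muD.
have TP := leaves_sub lP.
rewrite mu_keep//; last by left.
by rewrite nu_keep// nuv// modified_errorE// ?eT// muv.
Qed.

Lemma tree_errorE T : full_rooted_subtree Omega ch T -> finite_set T ->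
  tree_error ch e T = (\sum_(P \in leaves ch T) e P)%:E.
Proof.
move=> frT fT; have fl := leaves_finite ch fT.
rewrite /tree_error esum_fset//; first exact: fsumEFin.
by move=> P; rewrite inE lee_fin => /leaves_sub/(subtree_cell frT)/e_ge0.
Qed.

Lemma reached_near_best N x S m : reached Omega ch conf e N x ->
  conforming_tree Omega ch conf S -> (m <= N)%N ->
  (tree_size ch conf R S <= m%:R%:E)%E ->
  exists2 j, (j <= m)%N & tree_size ch conf R S = j%:R%:E /\
  forall c : R, 0 <= c ->
   (N.+1 - j + Theta * j)%:R <= c * (N.+1 - j)%:R ->
  (tree_error ch e (tree x) <= c%:E * tree_error ch e S)%E.
Proof.
move=> rx cS mN sizeS.
have [v [rv _ _]] := reached_run rx.
have [j jm gS] := conforming_grown tree_ch ch_nonempty root_conforming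
  uniq_patches nec_patches cS sizeS.
exists j => //; split.
  exact: (grown_tree_size tree_ch ch_nonempty root_conforming uniq_patches).
move=> c c0 c_large.
have gT := run_grown rv.
have frT := grown_full_rooted tree_ch ch_nonempty root_conforming gT.
have [frS _] := cS.
rewrite !tree_errorE//; [|exact: (grown_finite _ _ _ _ gS)|exact: (grown_finite _ _ _ _ gT)].
have jN := leq_trans jm mN.
have pos : (0 : R) < (N.+1 - j)%:R by rewrite ltr0n subn_gt0 ltnS.
rewrite -EFinM lee_fin -(ler_pM2r pos).
apply: le_trans (run_near_best rv gS jN) _.
rewrite mulrAC ler_wpM2r//.
by apply: fsumr_ge0 => P /leaves_sub/(subtree_cell frS)/e_ge0.
Qed.

Lemma sigma_lower_bound (c : R) (x E : \bar R) : 0 < c ->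
  (forall S, conforming_tree Omega ch conf S -> (tree_size ch conf R S <= x)%E ->
    (E <= c%:E * tree_error ch e S)%E) ->
  (E <= c%:E * sigma Omega ch conf e x)%E.
Proof.
move=> c_gt0 bound; rewrite -lee_pdivrMl//; apply: le_ereal_inf_tmp.
by move=> _ [S [cS sizeS] <-]; rewrite lee_pdivrMl//; exact: bound.
Qed.

Lemma reached_size N x : reached Omega ch conf e N x ->
  tree_size ch conf R (tree x) = N%:R%:E.
Proof.
move=> /reached_run[v [/run_grown gT _ _]].
exact: (grown_tree_size tree_ch ch_nonempty root_conforming uniq_patches).
Qed.

End Runs.

Theorem theorem3 (R : realType) (d : nat) (Omega : set 'rV[R]_d)
  (ch : set 'rV[R]_d -> set (set 'rV[R]_d))
  (conf : set (set (set 'rV[R]_d))) (Theta : nat) (e : set 'rV[R]_d -> R) :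
  master_tree Omega ch ->
  conforming_class Omega ch conf ->
  unique_patches Omega ch conf ->
  necessary_patches Omega ch conf ->
  is_max_patch_size Omega ch conf R Theta ->
  (forall D, cell Omega ch D -> 0 <= e D) ->
  subadditive_errors Omega ch e ->
  (forall (N : nat) (x : state), reached Omega ch conf e N x ->
     (tree_error ch e (tree x) <=
      \big[Order.min/+oo]_(n < N.+1)
        (((N%:R + 1 + (Theta%:R - 1) * n%:R) / (N%:R - n%:R + 1))%R%:E *
         sigma Omega ch conf e n%:R%:E))%E) /\
  (exists C1 C2 : R, [/\ 0 < C1, 0 < C2 &
     forall T, output_tree Omega ch conf e T ->
       (tree_error ch e T <=
        C1%:E * sigma Omega ch conf e (C2%:E * tree_size ch conf R T))%E]).
Proof.
move=> [_ tree_ch _ ch_finite ch_two _ _] [_ _ root_conf] uniqP necP maxP e0 e_sub.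
have ch_nonempty D : cell Omega ch D -> ch D !=set0.
  move=> cD; apply/set0P/eqP => E.
  by have := ch_two _ cD; rewrite E fset_set0 cardfs0.
have near_best := reached_near_best tree_ch ch_finite ch_nonempty root_conf
  uniqP e0 e_sub necP maxP.
split=> [N x rx|].
  apply: le_bigmin => [|[n /= nN] _]; first exact: leey.
  have nN' : (n <= N)%N by [].
  have -> : (N%:R + 1 + (Theta%:R - 1) * n%:R : R) = (N.+1 - n + Theta * n)%:R.
    by rewrite natrD natrB ?leqW// natrM -natr1; ring.
  have -> : (N%:R - n%:R + 1 : R) = (N.+1 - n)%:R.
    by rewrite natrB ?leqW// -natr1; ring.
  have pos : (0 : R) < (N.+1 - n)%:R by rewrite ltr0n subn_gt0.
  have c_gt0 : (0 : R) < (N.+1 - n + Theta * n)%:R / (N.+1 - n)%:R.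
    by rewrite divr_gt0// ltr0n addn_gt0 subn_gt0 nN.
  apply: sigma_lower_bound => // S cS sizeS.
  have [j jn [_]] := near_best _ _ _ _ rx cS nN' sizeS.
  move=> bound; apply: bound; first exact: ltW.
  rewrite mulrAC ler_pdivlMr// -!natrM ler_nat.
  have := leq_mul (leqnn Theta) jn; have : (N.+1 - n <= N.+1 - j)%N by exact: leq_sub2l.
  move: (N.+1 - n)%N (N.+1 - j)%N (Theta * j)%N (Theta * n)%N => a b c f; nia.
(* If j <= N / 2 then j <= N + 1 - j, which absorbs Theta j. *)
exists Theta.+1%:R, 2^-1; split=> [||T [N [x [rx <-]]]].
- by rewrite ltr0n.
- by rewrite invr_gt0.
rewrite (reached_size tree_ch ch_nonempty root_conf uniqP e0 rx) -EFinM.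
apply: sigma_lower_bound => [|S cS sizeS]; first by rewrite ltr0n.
have sizeN : (tree_size ch conf R S <= N%:R%:E)%E.
  by apply: le_trans sizeS _; rewrite lee_fin ler_piMl// invf_le1 ?ler1n.
have [j jN [sizeE]] := near_best _ _ _ _ rx cS (leqnn N) sizeN.
move=> bound; apply: bound; first exact: ler0n.
have j2N : (j * 2 <= N)%N.
  by move: sizeS; rewrite sizeE lee_fin mulrC ler_pdivlMr// -natrM ler_nat.
rewrite -natrM ler_nat.
have : (j <= N.+1 - j)%N by lia.
by move: (N.+1 - j)%N => a; nia.
Qed.
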